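(* Let $T=\{t_1,\dots,t_k\}\subset\mathbb{Z}^d$ be a finite set of $k$ distinct elements, and let $m$ be a positive integer. Assume that there exists a $d_1\times d$ matrix $L_1$ with integer entries such that the columns $L_1t_1,\dots,L_1t_k$ of $L_1T$ are pairwise distinct and form a spectral (resp. $m$-spectral) set $T_1=\{L_1t_1,\dots,L_1t_k\}$ in $\mathbb{Z}^{d_1}$. Then $T$ itself is spectral (resp. $m$-spectral) in $\mathbb{Z}^d$.
   Context: A $k\times k$ complex matrix $H$ is Hadamard if all its entries have absolute value $1$ and $HH^*=kI$. A log-Hadamard matrix is a real square matrix $(h_{i,j})_{i,j=1}^k$ such that $(e^{2\pi i h_{i,j}})_{i,j=1}^k$ is Hadamard. For a finite set $T=\{t_1,\dots,t_k\}\subset\mathbb{Z}^d$ of $k$ distinct elements, $T$ also denotes the $d\times k$ matrix whose $j$th column is $t_j$. The set $T$ is called spectral (in $\mathbb{Z}^d$) if there exists a $k\times d$ real matrix $L$ such that $LT$ is log-Hadamard; such an $L$ is called a spectrum of $T$. For a positive integer $m$, $T$ is called $m$-spectral if it admits a spectrum $L$ all of whose entries are integer multiples of $1/m$. *)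

(* Defs.v *)
From HB Require Import structures.
From mathcomp Require Import all_boot all_order all_algebra.
From mathcomp Require Import spectral sesquilinear.
From mathcomp Require Import complex.
From mathcomp Require Import reals trigo.

Set Implicit Arguments.
Unset Strict Implicit.
Unset Printing Implicit Defensive.

Import Order.TTheory GRing.Theory Num.Theory.
Local Open Scope ring_scope.
Local Open Scope complex_scope.
Local Open Scope sesquilinear_scope.

Definition hadamard (R : realType) (k : nat) (H : 'M[R[i]]_k) : Prop :=
  (forall i j, `|H i j| = 1) /\ H *m H ^t* = (k%:R)%:M.

(** [expi x] is e^{ix}, by Euler's formula. *)
Definition expi (R : realType) (x : R) : R[i] := (cos x +i* sin x)%C.

Definition log_hadamard (R : realType) (k : nat) (h : 'M[R]_k) : Prop :=
  hadamard (map_mx (fun x : R => expi (2%:R * pi * x)) h).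

(** A finite set {t_1, ..., t_k} of k distinct elements of Z^d is given by the
    d x k integer matrix whose j-th column is t_j; this predicate says that the
    listed elements are distinct. *)
Definition distinct_cols (d k : nat) (T : 'M[int]_(d, k)) : Prop :=
  injective (fun j : 'I_k => col j T).

Definition is_spectrum (R : realType) (d k : nat)
    (L : 'M[R]_(k, d)) (T : 'M[int]_(d, k)) : Prop :=
  log_hadamard (L *m map_mx intr T).

(** Distinctness of the columns is not part of [spectral] and [m_spectral]. *)
Definition spectral (R : realType) (d k : nat) (T : 'M[int]_(d, k)) : Prop :=
  exists L : 'M[R]_(k, d), is_spectrum L T.

Definition m_spectral (R : realType) (m d k : nat) (T : 'M[int]_(d, k)) :
    Prop :=
  exists L : 'M[R]_(k, d),
    (forall i j, exists z : int, L i j = z%:~R / m%:R) /\ is_spectrum L T.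

(* Main.v *)
Require Import Defs.
From mathcomp Require Import all_boot all_order all_algebra.
From mathcomp Require Import reals.

Local Open Scope ring_scope.

(** A spectrum [L] of [L1 *m T] pulls back along [L1]: by associativity
    [(L *m L1) *m T = L *m (L1 *m T)], so the log-Hadamard matrix is literally
    the same one. As [L1] is integral, the entries of [L *m L1] are integer
    combinations of those of [L], which keeps them in (1/m)Z in the m-spectral
    case. *)

Lemma is_spectrum_pullback (R : realType) (d d1 k : nat) (L1 : 'M[int]_(d1, d))
    (T : 'M[int]_(d, k)) (L : 'M[R]_(k, d1)) :
  is_spectrum L (L1 *m T) -> is_spectrum (L *m map_mx intr L1) T.
Proof. by rewrite /is_spectrum map_mxM mulmxA. Qed.

Lemma mulmx_int_multiples (R : realType) (m p q r : nat) (L : 'M[R]_(p, q))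
    (A : 'M[int]_(q, r)) :
  (forall i j, exists z : int, L i j = z%:~R / m%:R) ->
  forall i j, exists z : int, (L *m map_mx intr A) i j = z%:~R / m%:R.
Proof.
move=> L_int i j; rewrite mxE.
apply: (big_ind (fun x : R => exists z : int, x = z%:~R / m%:R)).
- by exists 0; rewrite GRing.mul0r.
- move=> _ _ [y ->] [z ->]; exists (y + z).
  by rewrite GRing.rmorphD GRing.mulrDl.
- move=> l _; have [z ->] := L_int i l.
  by exists (z * A l j); rewrite mxE GRing.rmorphM GRing.mulrAC.
Qed.

Theorem proposition2p2 (R : realType) (d k : nat) (T : 'M[int]_(d, k))
    (hT : distinct_cols T) (m : nat) (hm : (0 < m)%N)
    (d1 : nat) (L1 : 'M[int]_(d1, d)) (hL1 : distinct_cols (L1 *m T)) :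
  (spectral R (L1 *m T) -> spectral R T) /\
  (m_spectral R m (L1 *m T) -> m_spectral R m T).
Proof.
split=> [[L specL] | [L [L_int specL]]]; exists (L *m map_mx intr L1).
  exact: is_spectrum_pullback.
by split; [exact: mulmx_int_multiples | exact: is_spectrum_pullback].
Qed.
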